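(* Let $k\geq 3$ and let $\Gamma_k'$ be the marked group $(\mathbb{Z},\{\pm 2,\pm 3,\ldots,\pm(2k-3)\})$. Then $\chi_B(F(2^{\Gamma_k'}))=k$.
   Context: A marked group is a finitely generated group $\Gamma$ with a finite symmetric generating set $S$ not containing the identity. The left shift action of $\Gamma$ on $2^\Gamma$ is $(g\cdot x)(h)=x(g^{-1}h)$; its free part is $F(2^\Gamma)=\{x\in 2^\Gamma : g\cdot x\neq x \text{ for all } g\neq \mathrm{id}\}$. The shift graph $F(2^\Gamma)$ is the graph on this free part joining distinct $x,y$ iff $s\cdot x=y$ for some $s\in S$. $\chi_B(G)$ denotes the Borel chromatic number: the least $k$ such that there is a Borel map $c$ from the vertex set to a $k$-element set with $c(x)\neq c(y)$ for adjacent $x,y$. *)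

(* Defs.v *)
From HB Require Import structures.
From mathcomp Require Import all_boot all_order all_algebra.
From mathcomp Require Import all_classical.
From mathcomp Require Import topology measure.
From mathcomp Require Import zify.

Set Implicit Arguments.
Unset Strict Implicit.
Unset Printing Implicit Defensive.

Import Order.TTheory GRing.Theory Num.Theory.

Local Open Scope classical_set_scope.

Section Generation.
Local Open Scope group_scope.

Definition generates (G : groupType) (S : set G) : Prop :=
  forall H : set G,
    H 1 -> (forall g h, H g -> H h -> H (g * h)) ->
    (forall g, H g -> H g^-1) -> S `<=` H -> forall g, H g.

Record markedGroup := MarkedGroup {
  mg_group :> groupType;
  mg_gens : set mg_group;
  mg_gens_finite : finite_set mg_gens;
  mg_gens_sym : forall s, mg_gens s -> mg_gens s^-1;
  mg_gens_non1 : ~ mg_gens 1;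
  mg_gens_generate : generates mg_gens
}.

End Generation.

Record topGraph := TopGraph {
  vertex : topologicalType;
  adj : vertex -> vertex -> Prop;
  adj_sym : forall x y, adj x y -> adj y x;
  adj_irr : forall x, ~ adj x x
}.

Definition borel_set (X : topologicalType) : set (set X) := <<s @open X >>.

Definition borel_colorable (G : topGraph) (n : nat) : Prop :=
  exists c : vertex G -> 'I_n,
    (forall A : set 'I_n, borel_set (c @^-1` A)) /\
    (forall x y, adj x y -> c x <> c y).

(* chi_B(G) = n; a predicate, since a Borel graph need not have any finite
   Borel coloring. *)
Definition borel_chromatic_number (G : topGraph) (n : nat) : Prop :=
  borel_colorable G n /\ forall m, borel_colorable G m -> (n <= m)%N.

Section Shift.
Local Open Scope group_scope.

Definition shift (G : groupType) (g : G) (x : {ptws G -> bool}) :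
    {ptws G -> bool} :=
  fun h => x (g^-1 * h).

Definition free_part (G : groupType) : set {ptws G -> bool} :=
  [set x | forall g : G, g <> 1 -> shift g x <> x].
#[global] Arguments free_part : clear implicits.

Lemma shift1 (G : groupType) (x : {ptws G -> bool}) : shift 1 x = x.
Proof. by apply/funext => h; rewrite /shift invg1 mul1g. Qed.

Lemma shiftM (G : groupType) (g h : G) (x : {ptws G -> bool}) :
  shift (g * h) x = shift g (shift h x).
Proof. by apply/funext => a; rewrite /shift invgM mulgA. Qed.

(* The set is coerced to its subtype, which carries the subspace topology. *)
Definition shift_adj (M : markedGroup) (x y : free_part M) : Prop :=
  x <> y /\ exists2 s : M, mg_gens s & shift s (set_val x) = set_val y.

Lemma shift_adj_sym (M : markedGroup) (x y : free_part M) :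
  shift_adj x y -> shift_adj y x.
Proof.
move=> [neq [s Ss sxy]]; split; first by move=> e; apply: neq.
exists s^-1; first exact: mg_gens_sym.
by rewrite -sxy -shiftM mulVg shift1.
Qed.

Lemma shift_adj_irr (M : markedGroup) (x : free_part M) : ~ shift_adj x x.
Proof. by case. Qed.

Definition shift_graph (M : markedGroup) : topGraph :=
  TopGraph (@shift_adj_sym M) (@shift_adj_irr M).

End Shift.

Section GammaPrime.
Local Open Scope ring_scope.

(* The additive group of int, as a groupType. *)
Definition Zgrp : groupType := Algebra.to_multiplicative int.

Definition Gamma'_gens (k : nat) : set Zgrp :=
  [set s : int | 2 <= `|s| <= 2 * k%:Z - 3].

Lemma Gamma'_gens_finite k : finite_set (Gamma'_gens k).
Proof.
apply: (@sub_finite_set _ _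
  [set` map Posz (iota 0 (2 * k)) ++ map (fun n : nat => - n%:Z) (iota 0 (2 * k))]);
  last exact: finite_seq.
move=> s /andP[_ hs]; rewrite /= mem_cat; apply/orP.
have [n_ge|n_lt] := leP 0 (s : int); [left|right]; apply/mapP;
  exists `|(s : int)|%N; rewrite ?mem_iota; lia.
Qed.

Lemma Gamma'_gens_sym k s : Gamma'_gens k s -> Gamma'_gens k s^-1%g.
Proof. by move=> hs; rewrite /Gamma'_gens /= (normrN (s : int)). Qed.

Lemma Gamma'_gens_non1 k : ~ Gamma'_gens k 1%g.
Proof. by move=> /andP[]. Qed.

Lemma Gamma'_gens_generate k : (3 <= k)%N -> generates (Gamma'_gens k).
Proof.
move=> hk H H1 HM HV sH g.
have Hone : H (1 : int).
  have H3 : H (3 : int) by apply: sH; rewrite /Gamma'_gens /=; lia.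
  have H2 : H (2 : int) by apply: sH; rewrite /Gamma'_gens /=; lia.
  exact: (HM _ _ H3 (HV _ H2)).
have Hn (n : nat) : H n%:Z.
  elim: n => [//|n IH]; have := HM _ _ Hone IH.
  by rewrite -[n.+1]add1n PoszD.
case: g => n; first exact: Hn.
by rewrite NegzE; exact: (HV _ (Hn n.+1)).
Qed.

Definition Gamma' (k : nat) (hk : (3 <= k)%N) : markedGroup :=
  MarkedGroup (@Gamma'_gens_finite k) (@Gamma'_gens_sym k)
    (@Gamma'_gens_non1 k) (Gamma'_gens_generate hk).

End GammaPrime.

(* Main.v *)
Require Import Defs.
From HB Require Import structures.
From mathcomp Require Import all_boot all_algebra.
From mathcomp Require Import all_classical.
From mathcomp Require Import topology measure.
From mathcomp Require Import zify.

Set Implicit Arguments.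
Unset Strict Implicit.
Unset Printing Implicit Defensive.

Local Open Scope classical_set_scope.

(** On a single orbit, if points at distances [2, ..., 2k - 3] get different
    colors and there are fewer than [k] colors, then neighbors agree, since [b],
    [b + 1], [b + 3], ..., [b + 2k - 3] cannot carry [k] distinct colors; but
    then [b] and [b + 2] agree too, a contradiction.
    Conversely, if every orbit is cut into pieces of lengths [2k - 1] and [2k],
    coloring each point by half its distance to the end of its piece is proper.
    A Borel such cut exists: the graph joining points at distance at most [N] is
    countably colorable, so a greedy choice along the colors gives a Borel
    maximal independent set; its gaps are bounded and longer than [N], hence can
    be subdivided into pieces of these two lengths. *)

(** * Distance colorings of an orbit *)

Section DistanceColoring.
Context (C : finType) (k : nat) (c : nat -> C).
Hypothesis proper : forall i j, 2 <= j <= 2 * k - 3 -> c i <> c (i + j).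

Lemma distance_coloring_neighbors b : c b <> c b.+1 -> k <= #|C|.
Proof.
move=> neq; pose p (i : 'I_k) := b + i.*2.-1.
suff c_inj : injective (c \o p) by have := leq_card _ c_inj; rewrite card_ord.
suff lt_neq (i j : 'I_k) : i < j -> c (p i) <> c (p j).
  move=> i j /= e; apply: val_inj.
  by case: (ltngtP i j) => // /lt_neq; rewrite e.
move=> ij; have ltj := ltn_ord j.
have -> : p j = p i + (j.*2.-1 - i.*2.-1) by rewrite /p; lia.
have [j_ge2|j_lt2] := leqP 2 (j.*2.-1 - i.*2.-1); first by apply: proper; lia.
have -> : p i = b by rewrite /p; lia.
by have -> : j.*2.-1 - i.*2.-1 = 1; [lia | rewrite addn1].
Qed.

Lemma distance_coloring_card : 3 <= k -> k <= #|C|.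
Proof.
move=> k3; rewrite leqNgt; apply/negP => few.
have c_const b : c b = c b.+1.
  by apply: contrapT => /distance_coloring_neighbors; rewrite leqNgt few.
by apply: (@proper 0 2); [lia | rewrite (c_const 0) (c_const 1)].
Qed.

End DistanceColoring.

(** * Borel maximal independent sets *)

Lemma measurable_preimage d d' (X : measurableType d) (Y : measurableType d')
    (f : X -> Y) (B : set Y) :
  measurable_fun setT f -> measurable B -> measurable (f @^-1` B).
Proof. by move=> mf mB; rewrite -[X in measurable X]setTI; exact: mf. Qed.

Section IndependentSets.
Context d (X : measurableType d) (J : finType) (f : J -> X -> X).
Hypothesis mf : forall j, measurable_fun setT (f j).

Definition independent (M : set X) : Prop := forall j x, M x -> ~ M (f j x).

Definition separates_points (K : Type) (A : K -> set X) : Prop :=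
  forall x y, x <> y -> exists2 i, A i x & ~ A i y.

Hypothesis f_fixpoint_free : forall j x, f j x <> x.

(* The color of [x] is a choice, for each [j], of a member of the separating
   family containing [x] but not [f j x]. *)
Lemma countable_independent_cover (K : countType) (A : K -> set X) :
  (forall i, measurable (A i)) -> separates_points A ->
  exists U : nat -> set X,
    [/\ forall n, measurable (U n), forall n, independent (U n)
      & forall x, exists n, U n x].
Proof.
move=> mA sepA.
pose V (w : {ffun J -> K}) := \bigcap_j (A (w j) `\` f j @^-1` A (w j)).
exists (fun n => oapp V set0 (unpickle n)); split=> [n|n|x].
- case: unpickle => [w|] /=; last exact: measurable0.
  apply: fin_bigcap_measurable => [|j _]; first exact: finite_finset.
  by apply: measurableD => //; exact: measurable_preimage.
- by case: unpickle => [w|//] j x /(_ j I)[_ nA] /(_ j I)[].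
- have /choice[w hw] j : exists i, A i x /\ ~ A i (f j x).
    by have [i] := sepA _ _ (nesym (@f_fixpoint_free j x)); exists i.
  by exists (pickle (finfun w)); rewrite pickleK /= => j _; rewrite /= ffunE.
Qed.

Fixpoint greedy_set (U : nat -> set X) (n : nat) : set X :=
  if n is m.+1 then
    greedy_set U m `|` (U m `\` \bigcup_j f j @^-1` greedy_set U m)
  else set0.

Lemma measurable_greedy_set U n :
  (forall m, measurable (U m)) -> measurable (greedy_set U n).
Proof.
move=> mU; elim: n => [|n IH] /=; first exact: measurable0.
apply: measurableU => //; apply: measurableD => //.
apply: fin_bigcup_measurable => [|j _]; first exact: finite_finset.
exact: measurable_preimage.
Qed.

Hypothesis f_symmetric : forall j x, exists j', f j' (f j x) = x.

Lemma greedy_set_independent U n :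
  (forall m, independent (U m)) -> independent (greedy_set U n).
Proof.
move=> indU; elim: n => [//|n IH] j x /= [Mx|[Ux nMfx]] [Mfx|[Ufx nMx]].
- exact: IH Mfx.
- by have [j' fK] := f_symmetric j x; apply: nMx; exists j'; rewrite //= fK.
- by apply: nMfx; exists j.
- exact: indU Ufx.
Qed.

Lemma greedy_set_homo U : {homo greedy_set U : m n / m <= n >-> m `<=` n}.
Proof.
apply: homo_leq => [A|B A C|n]; [exact: subset_refl|exact: subset_trans|].
exact: subsetUl.
Qed.

Lemma maximal_independent_set (K : countType) (A : K -> set X) :
  (forall i, measurable (A i)) -> separates_points A ->
  exists M : set X, [/\ measurable M, independent M
    & forall x, M x \/ exists j, M (f j x)].
Proof.
move=> mA sepA.
have [U [mU indU coverU]] := countable_independent_cover mA sepA.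
exists (\bigcup_n greedy_set U n); split=> [|j x [m _ Mx] [n _ Mfx]|x].
- by apply: bigcupT_measurable => n; exact: measurable_greedy_set.
- have := @greedy_set_independent U (maxn m n) indU j x; apply.
    by apply: greedy_set_homo Mx; exact: leq_maxl.
  by apply: greedy_set_homo Mfx; exact: leq_maxr.
- have [n Ux] := coverU x.
  have [[j _ Mfx]|nMfx] := pselect ((\bigcup_j f j @^-1` greedy_set U n) x).
    by right; exists j, n.
  by left; exists n.+1 => //; right.
Qed.

End IndependentSets.

(** * Hitting times *)

Lemma measurable_fun_nat2 d (X : measurableType d) (a b : X -> nat)
    (h : nat -> nat -> nat) :
  measurable_fun setT a -> measurable_fun setT b ->
  measurable_fun setT (fun x => h (a x) (b x)).
Proof.
move=> ma mb _ Y _; rewrite [X in measurable X](_ : _ =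
    \bigcup_i (a @^-1` [set i] `&` b @^-1` (h i @^-1` Y))).
  apply: bigcupT_measurable => i.
  by apply: measurableI; exact: measurable_preimage.
apply/seteqP; split=> [x [_ Yx]|x [_ _ [<- Yx]]] //.
by exists (a x).
Qed.

Lemma measurable_fun_iter d (X : measurableType d) (f : X -> X) n :
  measurable_fun setT f -> measurable_fun setT (iter n f).
Proof.
move=> mf; elim: n => [|n IH]; first exact: measurable_id.
exact: measurableT_comp mf IH.
Qed.

Section HittingTime.
Context (X : Type) (S : X -> X) (M : set X).
Hypothesis recurrent : forall x, exists n, M (iter n S x).

Let recurrent_asbool x : exists n, `[< M (iter n S x) >].
Proof. by have [n Mn] := recurrent x; exists n; exact/asboolP. Qed.

Definition hitting_time (x : X) : nat := ex_minn (recurrent_asbool x).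

Lemma hitting_timeP x : M (iter (hitting_time x) S x) /\
  forall n, M (iter n S x) -> hitting_time x <= n.
Proof.
rewrite /hitting_time; case: ex_minnP => m /asboolP Mm le_m.
by split=> // n Mn; exact/le_m/asboolP.
Qed.

Lemma hitting_time_in x : M x -> hitting_time x = 0.
Proof. by move=> Mx; apply/eqP; rewrite -leqn0; apply: (hitting_timeP x).2. Qed.

Lemma hitting_time_notin x :
  ~ M x -> hitting_time x = (hitting_time (S x)).+1.
Proof.
move=> nMx; have [Mt le_t] := hitting_timeP x.
have [MSt le_St] := hitting_timeP (S x).
case def_t: (hitting_time x) Mt le_t => [//|t] Mt le_t.
apply/eqP; rewrite eqn_leq le_t ?iterSr//= ltnS.
by apply: le_St; rewrite -iterSr.
Qed.

End HittingTime.

Lemma measurable_hitting_time d (X : measurableType d) (S : X -> X)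
    (M : set X) (recM : forall x, exists n, M (iter n S x)) :
  measurable_fun setT S -> measurable M ->
  measurable_fun setT (hitting_time recM).
Proof.
move=> mS mM _ Y _; rewrite setTI [X in measurable X](_ : _ = \bigcup_(n in Y)
    (iter n S @^-1` M `\` \bigcup_(m in `I_n) iter m S @^-1` M)).
  have mMn n : measurable (iter n S @^-1` M).
    exact/measurable_preimage/mM/measurable_fun_iter.
  apply: bigcup_measurable => n _; apply: measurableD => //.
  by apply: bigcup_measurable.
apply/seteqP; split=> x /=; have [Mt le_t] := hitting_timeP recM x.
  move=> Yt; exists (hitting_time recM x) => //; split=> // -[m /= lt_m /le_t].
  by rewrite leqNgt lt_m.
move=> [n Yn [Mn min_n]].
suff -> : hitting_time recM x = n by [].
apply/eqP; rewrite eqn_leq le_t// leqNgt; apply/negP => lt_t.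
by apply: min_n; exists (hitting_time recM x).
Qed.

(** * Cutting intervals into pieces of two consecutive lengths *)

Definition counts_down (n a b : nat) : Prop :=
  if 0 < a then b = a.-1 else n.-1 <= b.

Lemma counts_down_modn n e : 1 < n -> counts_down n (e.+1 %% n) (e %% n).
Proof.
move=> n1; have := @modn_pred e.+1 n; rewrite gtn_eqF// => /(_ isT isT).
by rewrite /counts_down /dvdn lt0n; case: eqP => _ //= ->; exact: leqnn.
Qed.

(* An interval of length [L = q n + r] with [r <= q] is cut, from the right,
   into [r] pieces of length [n + 1] and then [q - r] pieces of length [n];
   [cut_dist n L e] is the distance to the end of its piece from the point at
   distance [e] from the end of the interval. *)
Definition cut_dist (n L e : nat) : nat :=
  let r := L %% n in
  if e < r * n.+1 then e %% n.+1 else (e - r * n.+1) %% n.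

Lemma cut_dist_le n L e : 0 < n -> cut_dist n L e <= n.
Proof.
move=> n0; rewrite /cut_dist; case: ifP => _; first by rewrite -ltnS ltn_pmod.
exact/ltnW/ltn_pmod.
Qed.

Lemma cut_dist0 n L : cut_dist n L 0 = 0.
Proof. by rewrite /cut_dist sub0n !mod0n if_same. Qed.

Lemma counts_down_cut_dist n L e :
  1 < n -> counts_down n (cut_dist n L e.+1) (cut_dist n L e).
Proof.
move=> n1; rewrite /cut_dist; move: (L %% n) => r.
have [ltS|geS] := ltnP e.+1 (r * n.+1).
  have := @counts_down_modn n.+1 e; rewrite (ltnW ltS) /counts_down.
  by case: ifP; lia.
have [lt|ge] := ltnP e (r * n.+1); last first.
  by rewrite subSn//; exact: counts_down_modn.
have def_eS : e.+1 = r * n.+1 by apply/eqP; rewrite eqn_leq lt geS.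
rewrite def_eS subnn mod0n /counts_down/=.
case: r def_eS {geS lt} => [//|r]; rewrite mulSn addSn => -[->].
by rewrite addnC modnMDl modn_small// leq_pred.
Qed.

Lemma cut_dist_pred_ge n L :
  1 < n -> n ^ 2 <= L -> n.-1 <= cut_dist n L L.-1.
Proof.
move=> n1 le_L; rewrite /cut_dist.
have := divn_eq L n; have := ltn_pmod L (ltnW n1).
set q := L %/ n; set r := L %% n => lt_r def_L.
have le_rq : r <= q by nia.
have [lt|ge] := ltnP L.-1 (r * n.+1).
  have def_q : q = r by nia.
  rewrite (_ : L.-1 = r.-1 * n.+1 + n); last by nia.
  by rewrite modnMDl modn_small; lia.
rewrite (_ : L.-1 - _ = (q - r).-1 * n + n.-1); last by nia.
by rewrite modnMDl modn_small; lia.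
Qed.

(** * Aperiodic automorphisms *)

Section Countdown.
Context (X : Type) (T : X -> X) (n : nat) (g : X -> nat).
Hypothesis countdown : forall x, counts_down n (g x) (g (T x)).

Lemma countdown_iter j x : j <= g x -> g (iter j T x) = g x - j.
Proof.
elim: j => [|j IH] lt_j; first by rewrite subn0.
have := countdown (iter j T x); rewrite IH; last exact: ltnW.
by rewrite /counts_down subn_gt0 lt_j /= => ->; lia.
Qed.

Lemma countdown_half_neq j x : 2 <= j -> j.+2 <= n ->
  (g x)./2 <> (g (iter j T x))./2.
Proof.
move=> j2 jn; have [le|lt] := leqP j (g x).
  by rewrite countdown_iter//; lia.
pose y := iter (g x).+1 T x.
have large_y : n.-1 <= g y.
  have := countdown (iter (g x) T x).
  by rewrite /counts_down countdown_iter// subnn.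
have -> : iter j T x = iter (j - (g x).+1) T y by rewrite -iterD subnK.
by rewrite countdown_iter; lia.
Qed.

End Countdown.

Lemma iter_can (X : Type) (S S' : X -> X) n :
  cancel S S' -> cancel (iter n S) (iter n S').
Proof. by move=> SK; elim: n => [//|n IH] x; rewrite iterSr iterS SK IH. Qed.

Lemma recurrent_of_syndetic (X : Type) (S S' : X -> X) (M : set X) N :
  cancel S S' ->
  (forall x, exists2 i, i <= N & M (iter i S x) \/ M (iter i S' x)) ->
  forall x, exists n, M (iter n S x).
Proof.
move=> SK syndetic x; have [i le_i [Mi|Mi]] := syndetic (iter N S x).
  by exists (i + N); rewrite iterD.
by exists (N - i); rewrite -(iter_can i SK (iter _ S x)) -iterD subnKC.
Qed.

Section AperiodicAutomorphism.
Context d (X : measurableType d) (T T' : X -> X).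
Hypotheses (mT : measurable_fun setT T) (mT' : measurable_fun setT T').
Hypotheses (TK : cancel T T') (T'K : cancel T' T).
Hypothesis aperiodic : forall n x, 0 < n -> iter n T x <> x.
Context (K : countType) (A : K -> set X).
Hypotheses (mA : forall i, measurable (A i)) (sepA : separates_points A).

Lemma measurable_marker_set N : exists M : set X,
  [/\ measurable M,
      forall i x, 0 < i <= N -> M x -> ~ M (iter i T x),
      forall x, exists n, M (iter n T x)
    & forall x, exists n, M (iter n T' x)].
Proof.
pose f (p : bool * 'I_N) := iter p.2.+1 (if p.1 then T else T').
have mf p : measurable_fun setT (f p).
  by apply: measurable_fun_iter; case: p.1.
have f_fixpoint_free p x : f p x <> x.
  case: p => [[] i] fx; first exact: aperiodic fx.
  by apply: (@aperiodic i.+1 x) => //; rewrite -[in LHS]fx (iter_can _ T'K).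
have f_symmetric p x : exists p', f p' (f p x) = x.
  by case: p => [[] i]; [exists (false, i) | exists (true, i)];
    apply: iter_can.
have [M [mM indM maxM]] :=
  maximal_independent_set mf f_fixpoint_free f_symmetric mA sepA.
have syndetic x : exists2 i, i <= N & M (iter i T x) \/ M (iter i T' x).
  have [Mx|[[b i] Mfx]] := maxM x; first by exists 0 => //; left.
  by exists i.+1; [exact: ltn_ord | case: b Mfx => Mfx; [left|right]].
exists M; split=> // [[//|i] x le_i|x|x].
- exact: (indM (true, Ordinal le_i)).
- exact: recurrent_of_syndetic TK syndetic x.
- apply: (recurrent_of_syndetic (N := N) T'K) x => x.
  by have [i le_i /or_comm] := syndetic x; exists i.
Qed.

Lemma measurable_countdown n : 1 < n -> exists g : X -> nat,
  [/\ measurable_fun setT g, forall x, g x <= n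
    & forall x, counts_down n (g x) (g (T x))].
Proof.
move=> n1; have [M [mM spaced recT recT']] := measurable_marker_set (n ^ 2).
pose to_next := hitting_time recT; pose from_prev := hitting_time recT' \o T'.
pose gap x := from_prev x + (to_next x).+1.
exists (fun x => cut_dist n (gap x) (to_next x)); split=> x.
- have m_next := measurable_hitting_time recT mT mM.
  have m_prev := measurableT_comp (measurable_hitting_time recT' mT' mM) mT'.
  pose h p e := cut_dist n (p + e.+1) e.
  exact: (measurable_fun_nat2 h m_prev m_next).
- by apply: cut_dist_le; exact: ltnW.
have from_prevT : from_prev (T x) = hitting_time recT' x.
  by rewrite /from_prev /= TK.
have [Mx|nMx] := pselect (M x).
  have -> : to_next x = 0 by exact: hitting_time_in.
  have gapT : gap (T x) = (to_next (T x)).+1.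
    by rewrite /gap from_prevT hitting_time_in.
  rewrite cut_dist0 /counts_down/= -[to_next (T x)]/(to_next (T x)).+1.-1 -gapT.
  apply: cut_dist_pred_ge => //; rewrite leqNgt gapT; apply/negP => short.
  apply: (spaced (to_next (T x)).+1 x); [lia | exact: Mx |].
  by rewrite iterSr; exact: (hitting_timeP recT (T x)).1.
have to_nextE : to_next x = (to_next (T x)).+1 by exact: hitting_time_notin.
have -> : gap (T x) = gap x.
  by rewrite /gap to_nextE from_prevT (hitting_time_notin recT') // addSnnS.
by rewrite to_nextE; exact: counts_down_cut_dist.
Qed.

Lemma measurable_distance_coloring k : 1 < k -> exists c : X -> nat,
  [/\ measurable_fun setT c, forall x, c x < k
    & forall j x, 2 <= j <= 2 * k - 3 -> c x <> c (iter j T x)].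
Proof.
move=> k1; have n1 : 1 < 2 * k - 1 by lia.
have [g [mg le_g countdown]] := measurable_countdown n1.
exists (fun x => (g x)./2); split=> [|x|j x /andP[j2 jk]].
- exact: (measurableT_comp (f := half)).
- by have := le_g x; lia.
- by apply: (countdown_half_neq countdown) => //; lia.
Qed.

End AperiodicAutomorphism.

(** * The free part of the shift *)

Definition borel_type (X : ptopologicalType) : Type :=
  g_sigma_algebraType (@open X).

HB.instance Definition _ (X : ptopologicalType) :=
  Measurable.on (borel_type X).

Lemma continuous_borel_measurable (X Y : ptopologicalType) (f : X -> Y) :
  continuous f -> measurable_fun setT (f : borel_type X -> borel_type Y).
Proof.
move=> cf.
apply: (@measurability _ _ (borel_type X) (borel_type Y) _ _ open) => //.
move=> _ [B oB <-]; rewrite setTI.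
by apply: sub_sigma_algebra; exact: open_comp.
Qed.

Section FreeShift.
Context (G : groupType).
Local Open Scope group_scope.

Lemma free_part_shift (g : G) x : free_part G x -> free_part G (shift g x).
Proof.
move=> free_x h h1 eq_x; apply: (free_x (g^-1 * h * g)).
  move=> /(congr1 (fun a => g * a * g^-1)).
  by rewrite !mulgA mulgV mul1g mulgK mulg1 mulgV.
by rewrite !shiftM eq_x -shiftM mulVg shift1.
Qed.

Definition free_shift (g : G) (x : free_part G) : free_part G :=
  SigSub (mem_set (free_part_shift (g := g) (set_valP x))).

Lemma free_shift1 x : free_shift 1 x = x.
Proof. by apply: val_inj; rewrite /= shift1. Qed.

Lemma free_shiftM g h x : free_shift (g * h) x = free_shift g (free_shift h x).
Proof. by apply: val_inj; rewrite /= shiftM. Qed.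

Lemma free_shiftK g : cancel (free_shift g) (free_shift g^-1).
Proof. by move=> x; rewrite -free_shiftM mulVg free_shift1. Qed.

Lemma free_shiftVK g : cancel (free_shift g^-1) (free_shift g).
Proof. by move=> x; rewrite -free_shiftM mulgV free_shift1. Qed.

Lemma iter_free_shift n g x : iter n (free_shift g) x = free_shift (g ^+ n) x.
Proof.
elim: n => [|n IH]; first by rewrite expg0 free_shift1.
by rewrite iterS IH -free_shiftM expgS.
Qed.

Lemma free_shift_neq g x : g <> 1 -> free_shift g x <> x.
Proof. by move=> g1 /(congr1 set_val); exact: (set_valP x). Qed.

Lemma pred1_free_part : free_part G (pred1 1 : G -> bool).
Proof.
move=> g g1 /(congr1 (fun x => x g)); rewrite /shift /= mulVg eqxx => /esym.
by move/eqP.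
Qed.

HB.instance Definition _ :=
  isPointed.Build (free_part G) (SigSub (mem_set pred1_free_part)).

Lemma coordinate_continuous (h : G) :
  continuous (fun x : free_part G => proj h (set_val x)).
Proof.
move=> x; apply: continuous_comp; first exact: initial_continuous.
exact: proj_continuous.
Qed.

Definition coordinate_cylinder (p : G * bool) :
    set (borel_type (free_part G)) :=
  (fun x => set_val x p.1) @^-1` [set p.2].

Lemma measurable_coordinate_cylinder p : measurable (coordinate_cylinder p).
Proof.
apply: sub_sigma_algebra; apply: open_comp; last exact: discrete_open.
by move=> x _; exact: coordinate_continuous.
Qed.

Lemma coordinate_cylinders_separate : separates_points coordinate_cylinder.
Proof.
move=> x y neq_xy; have [h neq_h] : exists h, set_val x h <> set_val y h.
  apply/existsNP => eq_xy; apply: neq_xy; apply: val_inj; exact/funext.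
by exists (h, set_val x h) => //= /esym.
Qed.

Lemma free_shift_continuous g : continuous (free_shift g).
Proof.
apply: continuous_comp_initial => x.
have shift_filter : Filter ((set_val \o free_shift g) @ x).
  exact/fmap_filter/nbhs_filter.
apply/cvg_sup => h U [_ [[V oV <-] Vx]] /filterS; apply.
apply: (@coordinate_continuous (g^-1 * h) x V).
exact: open_nbhs_nbhs.
Qed.

Lemma measurable_free_shift g : measurable_fun setT
  (free_shift g : borel_type (free_part G) -> borel_type (free_part G)).
Proof. exact: (continuous_borel_measurable (@free_shift_continuous g)). Qed.

End FreeShift.

Lemma shift_adjE (M : markedGroup) (x y : free_part M) :
  shift_adj x y <-> exists2 s : M, mg_gens s & free_shift s x = y.
Proof.
split=> [[_ [s Ss sxy]]|[s Ss <-]].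
  by exists s => //; exact: val_inj.
split; last by exists s.
apply: nesym; apply: free_shift_neq => s1.
by apply: (@mg_gens_non1 M); rewrite -s1.
Qed.

(** * The shift graph of the integers *)

Section IntegerShift.
Context (k : nat) (hk : 3 <= k).
Local Notation T := (free_shift (1%R : Zgrp)).

Lemma iter_unit_shift n x : iter n T x = free_shift (Posz n : Zgrp) x.
Proof. by rewrite iter_free_shift -[Posz n in RHS]natz. Qed.

Lemma Gamma'_adjE (x y : free_part Zgrp) :
  @adj (shift_graph (Gamma' hk)) x y <->
  exists2 n, 2 <= n <= 2 * k - 3 & y = iter n T x \/ x = iter n T y.
Proof.
split=> [/shift_adjE[[n|n] hn <-]|[n hn xy]].
- exists n; first by move: hn; rewrite /= /Gamma'_gens /=; lia.
  by left; rewrite iter_unit_shift.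
- exists n.+1; first by move: hn; rewrite /= /Gamma'_gens /=; lia.
  by right; rewrite iter_unit_shift (free_shiftK (Negz n : Zgrp)).
have gens_n : mg_gens (Posz n : Gamma' hk) by rewrite /= /Gamma'_gens /=; lia.
by case: xy => ->; rewrite iter_unit_shift; [|apply: adj_sym];
  apply/shift_adjE; exists (Posz n : Zgrp).
Qed.

Lemma unit_shift_aperiodic n x : 0 < n -> iter n T x <> x.
Proof.
move=> n0; rewrite iter_unit_shift; apply: free_shift_neq.
by move=> n1; change (Posz n = 0%R) in n1; lia.
Qed.

Lemma unit_shift_coloring : exists c : borel_type (free_part Zgrp) -> nat,
  [/\ measurable_fun setT c, forall x, c x < k
    & forall j x, 2 <= j <= 2 * k - 3 -> c x <> c (iter j T x)].
Proof.
apply: (@measurable_distance_coloring _ (borel_type (free_part Zgrp))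
  T (free_shift (1%R : Zgrp)^-1%g) _ _ _ _ unit_shift_aperiodic
  (int * bool)%type (@coordinate_cylinder Zgrp)).
- exact: measurable_free_shift.
- exact: measurable_free_shift.
- exact: free_shiftK.
- exact: free_shiftVK.
- exact: (@measurable_coordinate_cylinder Zgrp).
- exact: (@coordinate_cylinders_separate Zgrp).
- exact: ltnW.
Qed.

Lemma shift_graph_colorable : borel_colorable (shift_graph (Gamma' hk)) k.
Proof.
have [c [mc ltc cP]] := unit_shift_coloring.
exists (fun x => Ordinal (ltc x)); split=> [A|x y].
  rewrite [X in borel_set X](_ : _ = c @^-1` (val @` A)).
    exact: measurable_preimage mc _.
  apply/seteqP; split=> x /=; first by exists (Ordinal (ltc x)).
  by case=> i Ai ci; rewrite (_ : Ordinal _ = i)//; exact: val_inj.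
move=> /Gamma'_adjE[n hn [->|->]] /(congr1 val)/=; first exact: cP.
by move=> /esym; exact: cP.
Qed.

End IntegerShift.

Lemma shift_graph_colors_ge k (hk : 3 <= k) m :
  borel_colorable (shift_graph (Gamma' hk)) m -> k <= m.
Proof.
move=> [c [_ proper]]; rewrite -[m]card_ord.
pose orbit n : free_part Zgrp := iter n (free_shift (1%R : Zgrp)) point.
apply: (distance_coloring_card (c := c \o orbit)) => // i j hj.
apply: proper; apply/Gamma'_adjE; exists j => //.
by left; rewrite /orbit addnC iterD.
Qed.

Theorem theorem6 (k : nat) (hk : (3 <= k)%N) :
  borel_chromatic_number (shift_graph (Gamma' hk)) k.
Proof.
by split=> [|m]; [exact: shift_graph_colorable | exact: shift_graph_colors_ge].
Qed.
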